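(* Let $L:X\to Y$ be a continuous linear surjection between Banach spaces. Let $C\subset X$ be a convex finite-dimensional bounded subset of $X$ such that the boundary $\partial(C)$ contains no segments parallel to the kernel $\mathrm{Ker}(L)$. Then the restriction $L|_C:C\to L(C)$ is an open mapping.
   Context: Banach spaces are over $\mathbb R$. A convex set $C$ is finite-dimensional if its affine hull $\mathrm{aff}(C)$ is finite-dimensional; $C$ is not assumed to be closed. A point $m\in C$ is an inner point of $C$ if, for some $\varepsilon>0$, the intersection of $\mathrm{aff}(C)$ with the open ball of radius $\varepsilon$ centered at $m$ is contained in $C$; $\mathrm{int}(C)$ denotes the set of inner points (the interior of $C$ relative to $\mathrm{aff}(C)$). The boundary is the relative boundary $\partial(C)=\overline{C}\setminus\mathrm{int}(C)$, where $\overline{C}$ is the closure of $C$; it may contain points not belonging to $C$. A segment here is a nondegenerate segment $[x_1,x_2]$, $x_1\ne x_2$; it is parallel to $\mathrm{Ker}(L)$ if $x_1-x_2\in\mathrm{Ker}(L)$. The sets $C$ and $L(C)$ carry the subspace topologies. *)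

(* Defs.v *)
From HB Require Import structures.
From mathcomp Require Import all_boot all_order all_algebra.
From mathcomp Require Import all_classical all_reals all_analysis.

Set Implicit Arguments.
Unset Strict Implicit.
Unset Printing Implicit Defensive.

Import Order.TTheory GRing.Theory Num.Theory.
Import numFieldNormedType.Exports.

Local Open Scope classical_set_scope.
Local Open Scope ring_scope.

Definition affine_set (R : realType) (V : lmodType R) (A : set V) : Prop :=
  forall (x y : V) (t : R), A x -> A y -> A ((1 - t) *: x + t *: y).

Definition aff (R : realType) (V : lmodType R) (A : set V) : set V :=
  smallest (@affine_set R V) A.

(* For an affine set A: A is empty, or a translate of the linear span of a
   finite family e. *)
Definition affine_fin_dim (R : realType) (V : lmodType R) (A : set V) : Prop :=
  forall x0 : V, A x0 -> exists (n : nat) (e : 'I_n -> V),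
    A = [set x0 + \sum_(i < n) c i *: e i | c in [set: 'I_n -> R]].

Definition convex_fin_dim (R : realType) (V : lmodType R) (C : set V) : Prop :=
  affine_fin_dim (aff C).

Definition inner_points (R : realType) (V : normedModType R) (C : set V)
    : set V :=
  [set m | C m /\ exists2 e : R, 0 < e & aff C `&` ball m e `<=` C].

(* The closure is taken in the whole space, so this set need not lie in C. *)
Definition rel_boundary (R : realType) (V : normedModType R) (C : set V)
    : set V :=
  closure C `\` inner_points C.

Definition segment (R : realType) (V : lmodType R) (x1 x2 : V) : set V :=
  [set (1 - t) *: x1 + t *: x2 | t in `[0 : R, 1]].

Definition open_map (S T : topologicalType) (f : S -> T) : Prop :=
  forall U : set S, open U -> open (f @` U).

(* f|_A : A -> f(A), as a map between the subtypes of A and of f @` A; the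
   library equips these subtypes with the topology induced by the inclusion,
   i.e. with the subspace topology (unlike the type [subspace A], in which the
   points outside A are kept as isolated points). *)
Definition restr_image (S T : Type) (f : S -> T) (A : set S)
    : set_type A -> set_type (f @` A) :=
  sigLR [fun f in A].

(* Main.v *)
Require Import Defs.
From HB Require Import structures.
From mathcomp Require Import all_boot all_order all_algebra.
From mathcomp Require Import all_classical all_reals all_analysis.
From mathcomp Require Import lra.

Set Implicit Arguments.
Unset Strict Implicit.
Unset Printing Implicit Defensive.

Import Order.TTheory GRing.Theory Num.Theory.
Import numFieldNormedType.Exports.

Local Open Scope classical_set_scope.
Local Open Scope ring_scope.

(** The theorem is local. Let [x] be a point of [C] and [O] an open set around
    it; every [c] in [C] whose image is close enough to [L x] must have the
    same image as some point of [C] lying in [O] ([lifts_near] below). Since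
    [C] is bounded and spans a finite-dimensional affine space, its closure is
    compact and contained in [aff C] ([closure_compact_sub_aff]). By
    compactness the points of the closure whose images are close to [L x] are
    close to the fibre of [L] over [L x] ([compact_fibre_tube]). Two cases
    arise.

    If [x] is the only point of [closure C] in its fibre, then any [c] in [C]
    with [L c] close to [L x] is itself close to [x], and it is its own lift
    ([lifts_near_isolated_point]).

    Otherwise the fibre contains a second point [x'] of [closure C]. The segment
    from [x] to [x'] lies in [closure C] and is parallel to the kernel, so by
    hypothesis it meets the relative interior of [C]. Sliding an inner point of
    this segment towards [x] keeps it inner ([inner_points_segment]), so there
    is an inner point [w] of [C] in [O] with [L w = L x]. Around such a point
    lifts come from a translation ([lifts_near_inner_point]): a point [c] with
    [L c] close to [L x] is close to some [k] in the fibre, and [c - k + w] is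
    then in [aff C], close to [w], hence in [C], and has the image of [c]. *)

(** * Finite-dimensional spans in a normed space *)

Section FiniteDimension.
Variables (R : realType) (V : normedModType R).

Definition lincomb n (e : 'I_n -> V) (c : 'I_n -> R) : V :=
  \sum_(i < n) c i *: e i.

Definition lincomb_box n (e : 'I_n -> V) (M : R) : set V :=
  [set lincomb e c | c in [set c | forall i, `|c i| <= M]].

Lemma continuous_sum (T : topologicalType) (I : Type) (s : seq I)
    (f : I -> T -> V) :
  (forall i, continuous (f i)) -> continuous (fun v => \sum_(i <- s) f i v).
Proof.
move=> fc; elim: s => [|i s IHs].
  have -> : (fun v => \sum_(i <- [::]) f i v) = cst 0.
    by apply/funext => v; rewrite big_nil.
  exact: cst_continuous.
have -> : (fun v => \sum_(j <- i :: s) f j v) =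
    (fun v => f i v + \sum_(j <- s) f j v).
  by apply/funext => v; rewrite big_cons.
by move=> v; apply: cvgD; [exact: fc | exact: IHs].
Qed.

Lemma lincomb_box_compact n (e : 'I_n -> V) (M : R) :
  compact (lincomb_box e M).
Proof.
have -> : lincomb_box e M = (fun v : 'rV[R]_n => lincomb e (v ord0)) @`
    [set v : 'rV[R]_n | forall i, `[- M, M]%classic (v ord0 i)].
  apply/seteqP; split => [_ [c cM <-]|_ [v vM <-]].
    exists (\row_i c i); first by move=> i /=; rewrite mxE in_itv /= -ler_norml.
    by apply: eq_bigr => i _; rewrite mxE.
  exists (v ord0) => // i; have := vM i.
  by rewrite /= in_itv /= -ler_norml.
apply: continuous_compact; last first.
  apply: (@rV_compact _ n (fun=> `[- M, M]%classic)) => _.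
  exact: segment_compact.
apply: continuous_subspaceT; apply: continuous_sum => i v.
exact: (cvgZr_tmp (coord_continuous (j := i) (x:= v))).
Qed.

(** The family [e] may be linearly dependent, so only some choice of
    coordinates of each vector of the span can be bounded by its norm. *)
Definition bounded_coordinates n (e : 'I_n -> V) (M : R) :=
  forall c, exists2 c', lincomb e c' = lincomb e c &
    forall i, `|c' i| <= M * `|lincomb e c|.

(** A limit [p] of the span is a limit of vectors of norm at most [`|p| + 1];
    these have coordinates in a fixed box, whose image is compact, hence
    closed. *)
Lemma lincomb_closed n (e : 'I_n -> V) (M : R) :
  0 <= M -> bounded_coordinates e M -> closed (range (lincomb e)).
Proof.
move=> M0 eM p clp.
have Kp : lincomb_box e (M * (`|p| + 1)) p.
  apply: compact_closed; [exact: norm_hausdorff|exact: lincomb_box_compact|].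
  move=> B Bp.
  have [] := clp (B `&` ball p 1).
    by apply: filterI => //; exact: nbhsx_ballx.
  move=> w [[c _ cw] [Bw pw]]; exists w; split => //.
  have [c' c'w c'M] := eM c.
  exists c'; last by rewrite c'w.
  move=> i /=; apply: (le_trans (c'M i)); rewrite ler_wpM2l// cw.
  rewrite -ball_normE /= in pw.
  have := ler_normD p (w - p); rewrite addrC subrK distrC; lra.
by case: Kp => c _ <-; exists c.
Qed.

Lemma lincomb_recl n (e : 'I_n.+1 -> V) c :
  lincomb e c = c ord0 *: e ord0
    + lincomb (fun i => e (lift ord0 i)) (fun i => c (lift ord0 i)).
Proof. by rewrite /lincomb big_ord_recl. Qed.

Lemma lincombDZ n (e : 'I_n -> V) (a : R) b c :
  a *: lincomb e b + lincomb e c = lincomb e (fun i => a * b i + c i).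
Proof.
rewrite /lincomb scaler_sumr -big_split /=; apply: eq_bigr => i _.
by rewrite scalerA scalerDl.
Qed.

(** Induction on the size of the family. If the first vector lies in the span of
    the others, it is given the coordinate 0. Otherwise, that span being closed,
    the first vector is at distance at least some [d > 0] from it, so the first
    coordinate of [v] is at most [`|v| / d]; subtracting its contribution leaves
    a vector of the smaller span whose norm is controlled by that of [v]. *)
Lemma exists_bounded_coordinates n (e : 'I_n -> V) :
  exists2 M, 0 <= M & bounded_coordinates e M.
Proof.
elim: n e => [e|n IHn e].
  by exists 0 => // c; exists c => // -[].
set f := fun i => e (lift ord0 i); have [M M0 fM] := IHn f.
pose cons (a : R) (c : 'I_n -> R) (i : 'I_n.+1) := oapp c a (unlift ord0 i).
have consE a c : lincomb e (cons a c) = a *: e ord0 + lincomb f c.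
  rewrite lincomb_recl /cons unlift_none /=; congr (_ + lincomb f _).
  by apply/funext => i; rewrite liftK.
have [[b _ be]|We] := pselect (range (lincomb f) (e ord0)).
  exists M => // c.
  have cE : lincomb e c =
      lincomb f (fun i => c ord0 * b i + c (lift ord0 i)).
    by rewrite -lincombDZ be -lincomb_recl.
  have [c' c'E c'M] := fM (fun i => c ord0 * b i + c (lift ord0 i)).
  exists (cons 0 c').
    by rewrite consE scale0r add0r c'E cE.
  move=> i; rewrite /cons; case: unliftP => [j _|_] /=.
    by rewrite cE; exact: c'M.
  by rewrite normr0 mulr_ge0.
have [d d0 fd] : exists2 d, 0 < d & forall c, d <= `|e ord0 - lincomb f c|.
  have : open (~` range (lincomb f)).
    by apply: closed_openC; exact: lincomb_closed fM.
  rewrite openE => /(_ _ We)/nbhs_ballP[d /= d0 dW].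
  exists d => // c; rewrite leNgt; apply/negP => cd.
  by apply: (dW (lincomb f c)); [rewrite -ball_normE | exists c].
exists (d^-1 + M * (1 + `|e ord0| / d)).
  by rewrite addr_ge0 ?invr_ge0 ?(ltW d0)// mulr_ge0// addr_ge0// divr_ge0// ltW.
move=> c; set v := lincomb e c; set a := c ord0.
have vE : v = a *: e ord0 + lincomb f (fun i => c (lift ord0 i)).
  exact: lincomb_recl.
have aM : `|a| <= d^-1 * `|v|.
  have [->|a0] := eqVneq a 0.
    by rewrite normr0 mulr_ge0// invr_ge0 ltW.
  have := fd (fun i => - a^-1 * c (lift ord0 i) + 0).
  have f0 : lincomb f (fun=> 0) = 0 by apply: big1 => i _; rewrite scale0r.
  rewrite -lincombDZ f0 addr0 scaleNr opprK => dle.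
  have -> : v = a *: (e ord0 + a^-1 *: lincomb f (fun i => c (lift ord0 i))).
    by rewrite scalerDr scalerA divff// scale1r.
  rewrite normrZ mulrCA ler_peMr// mulrC ler_pdivlMr// mul1r.
  exact: dle.
have [c' c'E c'M] := fM (fun i => c (lift ord0 i)).
exists (cons a c'); first by rewrite consE c'E.
have wM : `|lincomb f (fun i => c (lift ord0 i))| <= (1 + `|e ord0| / d) * `|v|.
  have -> : lincomb f (fun i => c (lift ord0 i)) = v - a *: e ord0.
    by rewrite vE addrAC subrr add0r.
  apply: (le_trans (ler_normB _ _)); rewrite mulrDl mul1r lerD2l normrZ.
  by rewrite -mulrA mulrC ler_wpM2l.
move=> i; rewrite mulrDl /cons; case: unliftP => [j _|_] /=.
  apply: (le_trans (c'M j)); apply: ler_wpDl.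
    by rewrite mulr_ge0// invr_ge0 ltW.
  by rewrite -mulrA ler_wpM2l.
by rewrite ler_wpDr// !mulr_ge0// addr_ge0// divr_ge0// ltW.
Qed.
End FiniteDimension.

(** * Affine hull, closure and inner points *)

Section RelativeInterior.
Variables (R : realType) (V : normedModType R) (C : set V).

Lemma sub_aff : C `<=` aff C.
Proof. exact: sub_gen_smallest. Qed.

Lemma affine_aff : affine_set (aff C).
Proof.
move=> x y t xC yC A [affA CA].
by apply: (affA); [exact: xC|exact: yC].
Qed.

Lemma aff_translate p q r : aff C p -> aff C q -> aff C r -> aff C (p - q + r).
Proof.
move=> pC qC rC.
(* twice the midpoint of [p] and [r], minus [q] *)
have -> : p - q + r = (1 - 2) *: q + 2 *: ((1 - 2^-1) *: p + 2^-1 *: r).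
  rewrite scalerDr !scalerA mulrBr mulr1 divff// scale1r.
  rewrite [X in X *: q](_ : _ = -1); last by lra.
  rewrite [X in X *: p](_ : _ = 1); last by lra.
  by rewrite scaleN1r scale1r addrCA addrA.
by apply: affine_aff => //; exact: affine_aff.
Qed.

(** With bounded coordinates, [C] is contained in the translate [K] of the image
    of a coordinate box. As [K] is compact and made of points of [aff C], it
    also contains the closure, which need not be contained in [C]. *)
Lemma closure_compact_sub_aff :
  convex_fin_dim C -> bounded_set C ->
  compact (closure C) /\ closure C `<=` aff C.
Proof.
move=> Cfin Cbnd.
have [->|/set0P[x0 Cx0]] := eqVneq C set0.
  rewrite closure0; split; first exact: compact0.
  exact: sub0set.
have [n [e affE]] := Cfin _ (sub_aff Cx0).
have [M M0 eM] := exists_bounded_coordinates e.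
have [B CB] : exists B, forall x, C x -> `|x| <= B.
  have FC := globally_properfilter Cx0.
  by have /ex_bound[B CB] := Cbnd; exists B => x /CB.
pose K := @image V V (lincomb_box e (M * (B + `|x0|))) (fun w => x0 + w).
have Kc : compact K.
  apply: continuous_compact; last exact: lincomb_box_compact.
  apply: continuous_subspaceT => w.
  by apply: cvgD; [apply: cvg_cst|apply: cvg_id].
have Kcl : closed K by apply: compact_closed Kc; exact: norm_hausdorff.
have CK : C `<=` K.
  move=> x Cx; have := sub_aff Cx; rewrite affE => -[c _ cx].
  have [c' c'E c'M] := eM c.
  exists (lincomb e c'); last by rewrite c'E.
  exists c' => // i; apply: (le_trans (c'M i)); rewrite ler_wpM2l//.
  have -> : lincomb e c = x - x0 by rewrite -cx addrAC subrr add0r.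
  by rewrite (le_trans (ler_normB _ _))// lerD2r CB.
have clK : closure C `<=` K by exact: subset_trans (closureS CK) Kcl.
split; first exact: subclosed_compact (@closed_closure _ C) Kc clK.
apply: (subset_trans clK) => _ [_ [c _ <-] <-].
by rewrite affE; exists c.
Qed.

Lemma convex_set_combination : convex_set (C : set (convex_lmodType V)) ->
  forall x y t, C x -> C y -> 0 <= t <= 1 -> C ((1 - t) *: x + t *: y).
Proof.
move=> Cconv x y t Cx Cy /andP[t0 t1].
have t01 : Itv.spec (@Itv.num_sem R) (Itv.Real `[0%Z, 1%Z]) t.
  by rewrite /= /Itv.num_sem/= !in_itv /= t0 t1 num_real.
pose k : {i01 R} := Itv.mk t01.
have := Cconv y x k (mem_set Cy) (mem_set Cx).
by rewrite inE addrC.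
Qed.

Hypothesis Cconv : convex_set (C : set (convex_lmodType V)).

Lemma closure_segment x x' t : C x -> closure C x' -> 0 <= t <= 1 ->
  closure C ((1 - t) *: x + t *: x').
Proof.
move=> Cx Cx' t01 B.
have fc : {for x', continuous (fun w => (1 - t) *: x + t *: w)}.
  by apply: cvgD; [apply: cvg_cst|apply: cvgZl_tmp; apply: cvg_id].
move=> /fc /Cx'[w [Cw Bw]].
by exists ((1 - t) *: x + t *: w); split => //; exact: convex_set_combination.
Qed.

(** The homothety of centre [x] and ratio [s] maps the relative ball of radius
    [r] around [z] onto the relative ball of radius [s * r] around the new
    point, and maps [C] into itself by convexity. *)
Lemma inner_points_segment x z s : C x -> inner_points C z -> 0 < s <= 1 ->
  inner_points C ((1 - s) *: x + s *: z).
Proof.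
move=> Cx [Cz [r r0 zr]] /andP[s0 s1]; split.
  by apply: convex_set_combination; rewrite // ltW.
exists (s * r); first by rewrite mulr_gt0.
move=> p [pC]; rewrite -ball_normE /= => pr.
(* the preimage of [p] under the homothety *)
pose q := (1 - s^-1) *: x + s^-1 *: p.
have pE : p = (1 - s) *: x + s *: q.
  rewrite /q scalerDr !scalerA divff ?gt_eqF// scale1r addrA -scalerDl.
  by rewrite mulrBr mulr1 divff ?gt_eqF// addrA subrK subrr scale0r add0r.
rewrite pE; apply: convex_set_combination; rewrite ?(ltW s0)//.
apply: zr; split; first by apply: affine_aff => //; exact: sub_aff.
rewrite -ball_normE /= -(ltr_pM2l s0) -[X in X * `|_|]gtr0_norm// -normrZ.
suff -> : s *: (z - q) = (1 - s) *: x + s *: z - p by [].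
by rewrite {1}pE scalerBr [X in _ = X - _]addrC addrKA.
Qed.

Lemma inner_points_near x z (O : set V) : C x -> inner_points C z ->
  open O -> O x ->
  exists2 s, inner_points C ((1 - s) *: x + s *: z) & O ((1 - s) *: x + s *: z).
Proof.
move=> Cx zin Oo Ox.
have gc : (1 - s) *: x + s *: z @[s --> (0 : R)] --> x.
  rewrite -[X in _ --> X]addr0 -[X in _ --> X + _]scale1r -(scale0r z).
  rewrite -[X in _ --> X *: _ + _]subr0.
  apply: cvgD; apply: cvgZr_tmp; last exact: cvg_id.
  by apply: cvgB; [exact: cvg_cst | exact: cvg_id].
have /gc /nbhs_ballP[d /= d0 dO] : nbhs x O by exact: open_nbhs_nbhs.
exists (Num.min (d / 2) 1).
  apply: inner_points_segment => //.
  by rewrite lt_min ge_min lexx orbT ltr01 divr_gt0.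
apply: dO; rewrite -ball_normE /= sub0r normrN ger0_norm.
  by rewrite gt_min; apply/orP; left; lra.
by rewrite le_min ler01 andbT divr_ge0// ltW.
Qed.

End RelativeInterior.

(** * Lifting points of the image *)

(** The part of [K] outside [G] is compact, so its image is closed; this image
    misses [y], and its complement is the required neighbourhood. *)
Lemma compact_fibre_tube (S T : topologicalType) (f : S -> T) (K G : set S) y :
  hausdorff_space T -> continuous f -> compact K -> open G ->
  K `&` f @^-1` [set y] `<=` G ->
  exists N, [/\ open N, N y & K `&` f @^-1` N `<=` G].
Proof.
move=> Th fc Kc Go KG.
have KGc : compact (K `\` G).
  rewrite setDE; by apply: compact_closedI => //; exact: open_closedC.
exists (~` (f @` (K `\` G))); split.
- apply: closed_openC; apply: compact_closed => //.
  by apply: continuous_compact => //; exact: continuous_subspaceT.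
- by move=> [x [Kx nGx] fx]; apply: nGx; apply: KG.
- by move=> x [Kx Nx]; apply: contrapT => nGx; apply: Nx; exists x.
Qed.

(** Openness of the restriction of [L] to [C], localised at a value [y] and an
    open set [O] of the source. *)
Definition lifts_near (S T : topologicalType) (f : S -> T) (C O : set S)
    (y : T) : Prop :=
  exists N, [/\ open N, N y &
    forall c, C c -> N (f c) -> exists u, [/\ C u, O u & f u = f c]].

Lemma lifts_near_isolated_point (S T : topologicalType) (f : S -> T)
    (C O : set S) x :
  hausdorff_space T -> continuous f -> compact (closure C) ->
  (forall x', closure C x' -> f x' = f x -> x' = x) -> open O -> O x ->
  lifts_near f C O (f x).
Proof.
move=> Th fc clc uniq_x Oo Ox.
have [|N [No Ny CN]] := compact_fibre_tube Th fc clc Oo (y := f x).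
  by move=> x' [/= clx' fx']; rewrite (uniq_x x').
exists N; split => // c Cc Nc; exists c; split => //.
by apply: CN; split => //; exact: subset_closure.
Qed.

Section LinearLift.
Variables (R : realType) (X Y : normedModType R) (L : {linear X -> Y}).
Hypothesis Lcont : continuous L.
Variable C : set X.
Hypotheses (Cfin : convex_fin_dim C) (Cbnd : bounded_set C).

(** If [c] is close to a point [k] of the fibre through [w], then translating
    [c] by [w - k] brings it close to [w] without changing its image; the
    translate stays in [aff C] because [k], a point of the closure, is there. *)
Lemma lifts_near_inner_point w (O : set X) :
  inner_points C w -> open O -> O w -> lifts_near L C O (L w).
Proof.
move=> [Cw [r r0 wr]] Oo Ow.
have [clc claff] := closure_compact_sub_aff Cfin Cbnd.
have /nbhs_ballP[d /= d0 dO] : nbhs w O by exact: open_nbhs_nbhs.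
pose h := Num.min r d.
have h0 : 0 < h by rewrite lt_min r0.
pose F := closure C `&` L @^-1` [set L w].
pose G := \bigcup_(k in F) ball k h.
have [||N [No Ny CN]] :=
    compact_fibre_tube (@norm_hausdorff _ Y) Lcont clc (y := L w) (G := G).
- by apply: bigcup_open => k _; exact: ball_open.
- by move=> k Fk; exists k => //; exact: ballxx.
exists N; split => // c Cc Nc.
have [|k [clk Lk] kc] := CN c.
  by split => //; exact: subset_closure.
have wh : ball w h (c - k + w).
  move: kc; rewrite -!ball_normE /= => kc.
  by rewrite opprD addrCA subrr addr0 opprB.
exists (c - k + w); split.
- apply: wr; split; last by apply: le_ball wh; rewrite ge_min lexx.
  by apply: aff_translate; [exact: sub_aff|exact: claff|exact: sub_aff].
- by apply: dO; apply: le_ball wh; rewrite ge_min lexx orbT.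
- by rewrite linearD linearB /= Lk subrK.
Qed.

Hypothesis Cconv : convex_set (C : set (convex_lmodType X)).
Hypothesis Cseg : forall x1 x2 : X, x1 != x2 -> L (x1 - x2) = 0 ->
  ~ (segment x1 x2 `<=` rel_boundary C).

Lemma fibre_inner_point x x' :
  C x -> closure C x' -> x != x' -> L x' = L x ->
  exists2 z, inner_points C z & L z = L x.
Proof.
move=> Cx clx' xx' Lx'.
have Lxx' : L (x - x') = 0 by rewrite linearB /= Lx' subrr.
have /existsNP[_ /not_implyP[[t /= t01 <-] nbd]] := Cseg xx' Lxx'.
exists ((1 - t) *: x + t *: x').
  (* a point of [closure C] off the relative boundary is inner *)
  apply: contrapT => nin; apply: nbd; split => //.
  by apply: closure_segment => //; move: t01; rewrite in_itv.
by rewrite linearD !linearZ /= Lx' -scalerDl subrK scale1r.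
Qed.

Lemma lifts_near_point x (O : set X) :
  C x -> open O -> O x -> lifts_near L C O (L x).
Proof.
move=> Cx Oo Ox.
have [[x' [clx' xx' Lx']]|uniq_x] :=
    pselect (exists x', [/\ closure C x', x != x' & L x' = L x]); last first.
  apply: lifts_near_isolated_point => //.
    by have [] := closure_compact_sub_aff Cfin Cbnd.
  move=> x' clx' Lx'; have [//|xx'] := eqVneq x x'.
  by exfalso; apply: uniq_x; exists x'.
have [z zin Lz] := fibre_inner_point Cx clx' xx' Lx'.
have [s win Ow] := inner_points_near Cconv Cx zin Oo Ox.
have <- : L ((1 - s) *: x + s *: z) = L x.
  by rewrite linearD !linearZ /= Lz -scalerDl subrK scale1r.
exact: lifts_near_inner_point.
Qed.

End LinearLift.

Theorem theorem2p3 (R : realType) (X Y : completeNormedModType R)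
    (L : {linear X -> Y}) (Lcont : continuous L)
    (Lsurj : set_surj [set: X] [set: Y] L)
    (C : set X) (Cconv : convex_set (C : set (convex_lmodType X)))
    (Cfin : convex_fin_dim C) (Cbnd : bounded_set C)
    (Cseg : forall x1 x2 : X, x1 != x2 -> L (x1 - x2) = 0 ->
       ~ (segment x1 x2 `<=` rel_boundary C)) :
  open_map (@restr_image X Y L C).
Proof.
move=> U [W Wo <-].
rewrite openE => _ [[x xC] /= Wx <-].
have [N [No Ny CN]] := 
  lifts_near_point Lcont Cfin Cbnd Cconv Cseg (set_mem xC) Wo Wx.
exists (set_val @^-1` N); split; first by exists N.
  exact: Ny.
move=> [y yLC] /= Ny'; have [c Cc cy] := set_mem yLC; subst y.
have [u [Cu Ou Lu]] := CN c Cc Ny'.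
exists (SigSub (mem_set Cu)) => //.
by apply/val_inj.
Qed.
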